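(* Let $q>0$ be a real number. For every $n\geq 1$, the lattice $\mathbb{W}_n^q$ has exactly $n$ join-irreducible elements.
   Context: For a real $q>0$, a $q$-decreasing word of length $n$ is a binary word of length $n$ in which every maximal factor of the form $0^a1^b$ satisfies either $a=0$ or $q\cdot a>b$. $\mathcal{W}_n^q$ is the set of such words, and $\mathbb{W}_n^q=(\mathcal{W}_n^q,\leq)$ is ordered componentwise ($v\leq w$ iff $v_i\leq w_i$ for all $i$); it is a lattice. An element $P$ is join-irreducible if $P=R\vee S$ implies $P=R$ or $P=S$.
   Formalization: The least element is excluded from the join-irreducible elements, as is usual in lattice theory; under the literal definition it would also count, and the number would be n+1 (for n=1 both 0 and 1 would qualify). *)

(* Defs.v *)
From HB Require Import structures.
From mathcomp Require Import all_boot all_order all_algebra.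
From mathcomp Require Import boolp reals.

Set Implicit Arguments.
Unset Strict Implicit.
Unset Printing Implicit Defensive.

Import Order.TTheory GRing.Theory Num.Theory.
Local Open Scope ring_scope.

(* Binary words are sequences of booleans, with false for 0 and true for 1.
   [factor01 w i a b]: the factor of [w] starting at position [i] (counted
   from 0) and of length [a + b] is 0^a 1^b. *)
Definition factor01 (w : seq bool) (i a b : nat) : bool :=
  (i + a + b <= size w)%N &&
  (take (a + b) (drop i w) == nseq a false ++ nseq b true).

(* Maximality is among occurrences of factors of this form, an occurrence
   being the interval of positions [i, i + a + b[. *)
Definition maximal_factor01 (w : seq bool) (i a b : nat) : Prop :=
  factor01 w i a b /\
  forall i' a' b' : nat, factor01 w i' a' b' ->
    (i' <= i)%N -> (i + a + b <= i' + a' + b')%N ->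
    i' = i /\ (i' + a' + b' = i + a + b)%N.

Definition q_decreasing (R : realType) (q : R) (w : seq bool) : Prop :=
  forall i a b : nat, maximal_factor01 w i a b ->
    a = 0%N \/ b%:R < q * a%:R.

Record qword (R : realType) (q : R) (n : nat) := QWord {
  word_of :> n.-tuple bool;
  _ : `[< q_decreasing q word_of >]
}.

HB.instance Definition _ (R : realType) (q : R) (n : nat) :=
  [isSub for @word_of R q n].
HB.instance Definition _ (R : realType) (q : R) (n : nat) :=
  [Finite of qword q n by <:].

(* On bool, [x ==> y] is the order 0 <= 1. *)
Definition qword_le (R : realType) (q : R) (n : nat) : rel (qword q n) :=
  fun v w => [forall i : 'I_n, tnth v i ==> tnth w i].

Lemma factor01P (w : seq bool) (i a b : nat) :
  reflect [/\ (i + a + b <= size w)%N,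
    forall k, (i <= k < i + a)%N -> nth false w k = false &
    forall k, (i + a <= k < i + a + b)%N -> nth false w k = true]
  (factor01 w i a b).
Proof.
apply: (iffP andP) => [[le_w /eqP e]|[le_w h0 h1]].
  have nthE k : (i <= k < i + a + b)%N ->
      nth false w k = nth false (nseq a false ++ nseq b true) (k - i).
    move=> /andP[ik kl]; rewrite -e nth_take ?nth_drop ?subnKC //.
    by rewrite ltn_subLR // addnA.
  split=> // k /andP[k1 k2].
    rewrite nthE; last by rewrite k1 ltn_addr.
    by rewrite nth_cat size_nseq ltn_subLR // k2 nth_nseq if_same.
  rewrite nthE; last by rewrite k2 andbT (leq_trans (leq_addr _ _) k1).
  have ik : (i <= k)%N by exact: leq_trans (leq_addr _ _) k1.
  by rewrite nth_cat size_nseq ltn_subLR // ltnNge k1 /= nth_nseq -subnDA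
             ltn_subLR // k2.
split=> //; apply/eqP.
have sz : size (take (a + b) (drop i w)) = (a + b)%N.
  rewrite size_takel // size_drop leq_subRL ?addnA //.
  by apply: leq_trans le_w; rewrite -addnA leq_addr.
apply: (@eq_from_nth _ false); first by rewrite sz size_cat !size_nseq.
move=> k; rewrite sz => kl; rewrite nth_take // nth_drop nth_cat size_nseq.
case: ltnP => ka; rewrite nth_nseq.
  by rewrite ka h0 // leq_addr ltn_add2l.
rewrite ltn_subLR // kl h1 //.
by rewrite leq_add2l ka -addnA ltn_add2l.
Qed.

Lemma maximal_factor01_ex (w : seq bool) (i a b : nat) : factor01 w i a b ->
  exists i' a' b', [/\ maximal_factor01 w i' a' b',
    (i' <= i)%N & (i + a + b <= i' + a' + b')%N].
Proof.
have [m] := ubnP (size w - (a + b)); elim: m i a b => // m IH i a b lem f.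
have [M|M] := pselect (maximal_factor01 w i a b); first by exists i, a, b.
have [[i' [a' [b' [f' le1 le2 lt3]]]]|N] := pselect (exists i' a' b',
    [/\ factor01 w i' a' b', (i' <= i)%N, (i + a + b <= i' + a' + b')%N &
        (a + b < a' + b')%N]); last first.
  case: M; split=> // i' a' b' f' le1 le2.
  have [lt3|ge3] := ltnP (a + b) (a' + b').
    by case: N; exists i', a', b'.
  suff ii : i' = i.
    split=> //; apply/eqP; rewrite eqn_leq le2 andbT.
    by rewrite ii -!addnA leq_add2l.
  apply/eqP; rewrite eqn_leq le1 /= -(leq_add2r (a + b)) addnA.
  by rewrite (leq_trans le2) // -addnA leq_add2l.
have [] := IH i' a' b' _ f'.
  have /andP[h' _] := f'.
  rewrite -ltnS; apply: leq_trans lem; rewrite ltnS ltn_sub2l //.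
  by apply: leq_trans lt3 (leq_trans _ h'); rewrite -addnA leq_addl.
move=> i2 [a2 [b2 [M2 l1 l2]]]; exists i2, a2, b2; split=> //.
  exact: leq_trans le1.
exact: leq_trans l2.
Qed.

(* The meet of W_n^q is the componentwise minimum. *)
Lemma q_decreasing_meet (R : realType) (q : R) (x y z : seq bool) :
  size x = size z -> size y = size z ->
  (forall k, nth false z k = nth false x k && nth false y k) ->
  q_decreasing q x -> q_decreasing q y -> q_decreasing q z.
Proof.
move=> sx sy zE qx qy i a b [/factor01P[le_z h0 h1] M].
case: a => [|a] in le_z h0 h1 M *; [by left | right].
set p := (i + a)%N.
have zp : nth false z p = false by apply: h0; rewrite leq_addr addnS leqnn.
wlog xp : x y sx sy zE qx qy / nth false x p = false.
  move=> W; move: (zE p); rewrite zp; case xp: (nth false x p) => /= yp.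
    by apply: (W y x) => // k; rewrite zE andbC.
  exact: (W x y).
have fx : factor01 x p 1 b.
  apply/factor01P; split.
  - by rewrite sx addn1 -[p.+1]addnS.
  - by move=> k; rewrite addn1 ltnS -eqn_leq => /eqP <-.
  - move=> k; rewrite addn1 -[p.+1]addnS => /h1; rewrite zE.
    by case/andP.
have [i' [a' [b' [Mx li lb]]]] := maximal_factor01_ex fx.
have /factor01P[le_x g0 g1] := Mx.1.
have a'p : (p < i' + a')%N.
  rewrite ltnNge; apply/negP => ge.
  have := g1 p; rewrite xp ge /=.
  rewrite (leq_trans _ lb) => [/(_ isT)//|].
  by rewrite addn1 addSn ltnS leq_addr.
have a'0 : (0 < a')%N.
  by rewrite -(ltn_add2l i') addn0; apply: leq_ltn_trans a'p.
have qa' : b'%:R < q * a'%:R.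
  by have [e|//] := qx _ _ _ Mx; rewrite e in a'0.
have q0 : 0 < q.
  have : 0 < q * a'%:R by apply: le_lt_trans qa'; rewrite ler0n.
  by rewrite pmulr_lgt0 // ltr0n.
case: b => [|b] in le_z h1 M fx lb *; first by rewrite mulr_gt0 ?ltr0n.
have xp1 : nth false x p.+1 = true.
  have : nth false z p.+1.
    by rewrite -addnS h1 // leqnn /= [X in (_ < X)%N]addnS ltnS leq_addr.
  by rewrite zE => /andP[].
have ea : (i' + a' = p.+1)%N.
  apply/eqP; rewrite eqn_leq a'p andbT leqNgt; apply/negP => lt.
  have := g0 p.+1; rewrite xp1 lt andbT (leq_trans li) // => /(_ isT).
  by [].
have lbb : (b.+1 <= b')%N by move: lb; rewrite ea addn1 leq_add2l.
have fz : factor01 z i' a' b.+1.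
  apply/factor01P; split.
  - by rewrite ea /p -addnS.
  - by move=> k /g0 xk; rewrite zE xk.
  - by move=> k; rewrite ea /p -addnS => /h1.
have laa : (a' <= a.+1)%N.
  have [li2|li2] := leqP i i'.
    by rewrite -(leq_add2l i) [X in (_ <= X)%N]addnS -/p -ea leq_add2r.
  have [|e _] := M _ _ _ fz (ltnW li2).
    by rewrite ea [(i + a.+1)%N]addnS.
  by rewrite e ltnn in li2.
apply: (@le_lt_trans _ _ b'%:R); first by rewrite ler_nat.
by apply: lt_le_trans qa' _; rewrite ler_pM2l // ler_nat.
Qed.

Section QWordLattice.
Variables (R : realType) (q : R) (n : nat).
Implicit Types u v w : qword q n.

Fact qword_le_refl : reflexive (@qword_le R q n).
Proof. by move=> v; apply/forallP => i; apply: implybb. Qed.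

Fact qword_le_anti : antisymmetric (@qword_le R q n).
Proof.
move=> v w /andP[/forallP vw /forallP wv]; apply/val_inj/eq_from_tnth => i.
by apply/idP/idP; apply/implyP.
Qed.

Fact qword_le_trans : transitive (@qword_le R q n).
Proof.
move=> v u w /forallP uv /forallP vw; apply/forallP => i.
by apply/implyP => /(implyP (uv i)); apply/implyP.
Qed.

HB.instance Definition _ := Order.Le_isPOrder.Build (Order.Disp tt tt)
  (qword q n) qword_le_refl qword_le_anti qword_le_trans.

Lemma qwordP v : q_decreasing q v.
Proof. by apply/asboolP; case: v. Qed.

Fact qword_meet_subproof v w :
  `[< q_decreasing q [tuple tnth v i && tnth w i | i < n] >].
Proof.
apply/asboolP; apply: (q_decreasing_meet (x := v) (y := w)); try exact: qwordP.
- by rewrite !size_tuple.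
- by rewrite !size_tuple.
- move=> k; have [kn|kn] := ltnP k n; last first.
    by rewrite !nth_default ?size_tuple.
  by rewrite -[k]/(val (Ordinal kn)) -!tnth_nth tnth_mktuple.
Qed.

Definition qword_meet v w : qword q n := QWord (qword_meet_subproof v w).

Fact qword_lexI u v w :
  (u <= qword_meet v w)%O = (u <= v)%O && (u <= w)%O.
Proof.
apply/forallP/andP => [uvw|[/forallP uv /forallP uw] i].
  by split; apply/forallP => i; move: (uvw i);
    rewrite tnth_mktuple; case: (tnth u i) => //= /andP[].
by move: (uv i) (uw i); rewrite tnth_mktuple; case: (tnth u i) => //= -> ->.
Qed.

HB.instance Definition _ :=
  Order.POrder_isMeetSemilattice.Build _ (qword q n) qword_lexI.

Fact qword_top_subproof : `[< q_decreasing q [tuple of nseq n true] >].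
Proof.
apply/asboolP => i [|a] b [/factor01P[le_w h0 _] _]; [by left | exfalso].
have i_n : (i < n)%N.
  move: le_w; rewrite size_tuple; apply: leq_trans.
  by rewrite addnS addSn ltnS -addnA leq_addr.
have := h0 i; rewrite leqnn addnS ltnS leq_addr => /(_ isT).
by rewrite nth_nseq i_n.
Qed.

Definition qword_top : qword q n := QWord qword_top_subproof.

Fact qword_lex1 w : (w <= qword_top)%O.
Proof.
by apply/forallP => i; rewrite [X in _ ==> X](tnth_nth true) nth_nseq
  if_same implybT.
Qed.

HB.instance Definition _ := Order.hasTop.Build _ (qword q n) qword_lex1.

Definition qword_bot : qword q n := (\meet_(w : qword q n) w)%O.

Fact qword_le0x w : (qword_bot <= w)%O.
Proof. exact: meets_inf. Qed.

HB.instance Definition _ := Order.hasBottom.Build _ (qword q n) qword_le0x.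

(* The join is in general not the componentwise maximum, since the latter
   need not be q-decreasing; it is the least common upper bound. *)
Definition qword_join v w : qword q n :=
  (\meet_(u : qword q n | (v <= u)%O && (w <= u)%O) u)%O.

Fact qword_leUx v w u :
  (qword_join v w <= u)%O = (v <= u)%O && (w <= u)%O.
Proof.
apply/idP/idP => [le_u|]; last by move=> vwu; exact: (meets_inf (j := u)).
by apply/andP; split; apply: le_trans le_u; apply/meetsP => u' /andP[].
Qed.

HB.instance Definition _ :=
  Order.POrder_isJoinSemilattice.Build _ (qword q n) qword_leUx.

End QWordLattice.

(* As usual in lattice theory the least element, which is trivially never the
   join of two other elements, is not counted as join-irreducible. *)
Definition join_irreducible (d : Order.disp_t) (L : finTBLatticeType d)
    (P : L) : bool :=
  (P != \bot%O) &&
  [forall R : L, forall S : L,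
     (P == (R `|` S)%O) ==> ((P == R) || (P == S))].

(* Main.v *)
(** For a position [i], the least word of [W_n^q] with a 1 at [i] is
    0^i 1 0^(n-i-1) if [q i > 1]; otherwise every 0 before [i] would be followed
    too soon by a 1, and that word is 1^(i+1) 0^(n-i-1). In both cases erasing
    the 1 at [i] leaves a word of [W_n^q], so these [n] least words have a
    unique lower cover; hence they are join-irreducible and pairwise distinct.
    Every word is the join of those below it, so there are no others. *)
Require Import Defs.
From mathcomp Require Import all_boot all_order all_algebra.
From mathcomp Require Import boolp reals.
From mathcomp Require Import zify.

Set Implicit Arguments.
Unset Strict Implicit.
Unset Printing Implicit Defensive.

Import Order.TTheory GRing.Theory Num.Theory.
Local Open Scope ring_scope.

(** Terms are split off one at a time; the induction ends because the empty join is [\bot], which is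
    not join-irreducible. *)
Lemma join_irreducible_bigjoin (d : Order.disp_t) (L : finTBLatticeType d)
    (I : Type) (r : seq I) (A : pred I) (F : I -> L) (P : L) :
  join_irreducible P -> P = (\join_(i <- r | A i) F i)%O ->
  exists2 i, A i & P = F i.
Proof.
case/andP=> P0 /forallP irrP.
elim: r => [|i r IHr]; first by rewrite big_nil => PE; rewrite PE eqxx in P0.
rewrite big_cons; case: ifP => // Ai PE.
move/forallP/(_ (\join_(j <- r | A j) F j)%O): (irrP (F i)).
rewrite -PE eqxx /= => /orP[/eqP PF|/eqP /IHr //].
by exists i.
Qed.

Section JoinIrreducibleWords.
Variables (R : realType) (q : R) (n : nat).
Hypothesis q_gt0 : 0 < q.
Implicit Types (c d : nat) (i j k : 'I_n) (v w : qword q n).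

Lemma qword_leP v w :
  reflect (forall k, tnth v k -> tnth w k) (v <= w)%O.
Proof.
by apply: (iffP forallP) => vw k; [apply/implyP/vw | apply/implyP/vw].
Qed.

(* The word 0^c 1^(d-c) 0^(n-d). *)
Lemma q_decreasing_block c d :
    ((0 < c)%N -> (d - c)%N%:R < q * c%:R) ->
  q_decreasing q [tuple (c <= k < d)%N | k < n].
Proof.
move=> qc; set w := [tuple _ | _ < _].
have wE m : (m < n)%N -> nth false w m = (c <= m < d)%N.
  by move=> mn; rewrite -[m]/(val (Ordinal mn)) -tnth_nth tnth_mktuple.
move=> i [|a] b [/factor01P[le_w h0 h1] M]; [by left | right].
rewrite size_tuple in le_w.
case: b => [|b] in le_w h1 M *; first by rewrite mulr_gt0 ?ltr0n.
(* The last 0 and the first and last 1 of the factor show that its 1s start at [c] and end before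
   [d]. *)
have := h0 (i + a)%N ltac:(lia); rewrite wE; last by lia.
have := h1 (i + a.+1)%N ltac:(lia); rewrite wE; last by lia.
have := h1 (i + a.+1 + b)%N ltac:(lia); rewrite wE; last by lia.
move=> lt_d c_le c_gt; have ec : (i + a.+1)%N = c by lia.
(* The factor 0^c 1^(b+1) at position 0 contains the given one, so maximality identifies them. *)
have [i0 _] : 0%N = i /\ (0 + c + b.+1 = i + a.+1 + b.+1)%N.
  apply: M; [| lia | lia].
  apply/factor01P; split; first by rewrite size_tuple; lia.
    by move=> m m_c; rewrite wE; lia.
  by move=> m m_c; rewrite h1 // ec.
have -> : a.+1 = c by lia.
by apply: le_lt_trans (qc ltac:(lia)); rewrite ler_nat; lia.
Qed.

Definition block c d (h : (0 < c)%N -> (d - c)%N%:R < q * c%:R) : qword q n :=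
  QWord (introT (asboolP _) (q_decreasing_block h)).

Lemma tnth_block c d (h : (0 < c)%N -> (d - c)%N%:R < q * c%:R) k :
  tnth (block h) k = (c <= k < d)%N.
Proof. by rewrite tnth_mktuple. Qed.

(** Where the 1s of the least word with a 1 at [i] begin. Equality goes to the first case since b <
    q a is strict: q i = 1 already forbids 0^i 1. *)
Definition first_one i : nat := if q * i%:R <= 1 then 0%N else i.

Lemma first_one_le i : (first_one i <= i)%N.
Proof. by rewrite /first_one; case: ifP. Qed.

Fact least_word_subproof i :
  (0 < first_one i)%N -> (i.+1 - first_one i)%N%:R < q * (first_one i)%:R.
Proof. by rewrite /first_one; have [//|qi _] := leP (q * i%:R) 1; rewrite subSnn. Qed.

Fact least_word_cover_subproof i :
  (0 < first_one i)%N -> (i - first_one i)%N%:R < q * (first_one i)%:R.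
Proof.
rewrite /first_one; have [//|qi _] := leP (q * i%:R) 1; rewrite subnn.
exact: lt_trans qi.
Qed.

Definition least_word i := block (@least_word_subproof i).
Definition least_word_cover i := block (@least_word_cover_subproof i).

Lemma tnth_least_word i : tnth (least_word i) i.
Proof. by rewrite tnth_block first_one_le /=. Qed.

Lemma tnth_least_word_cover i : tnth (least_word_cover i) i = false.
Proof. by rewrite tnth_block ltnn andbF. Qed.

(** A 0 at [m] would put 01 inside a maximal 0^a 1^b with b >= 1 and a <= m + 1, whence 1 <= b < q a
    <= q (m + 1). *)
Lemma q_decreasing_prev_one (s : seq bool) (m : nat) :
    q_decreasing q s -> q * m.+1%:R <= 1 ->
  nth false s m.+1 -> nth false s m.
Proof.
move=> qs qm sm1; apply: contraTT qm => /negbTE sm; rewrite -ltNge.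
have ms : (m.+1 < size s)%N.
  by rewrite ltnNge; apply: contraL sm1 => ?; rewrite nth_default.
have f : factor01 s m 1 1.
  apply/factor01P; split; first by lia.
    by move=> k km; rewrite (_ : k = m) //; lia.
  by move=> k km; rewrite (_ : k = m.+1) //; lia.
have [i [a [b [Mx im mb]]]] := maximal_factor01_ex f.
have /factor01P[_ h0 h1] := Mx.1.
(* The 0 at [m] and the 1 at [m.+1] force i + a = m + 1. *)
have am : (m < i + a)%N.
  by rewrite ltnNge; apply/negP => am; have := h1 m ltac:(lia); rewrite sm.
have ma : (i + a <= m.+1)%N.
  by rewrite leqNgt; apply/negP => ma; have := h0 m.+1 ltac:(lia); rewrite sm1.
have [a0|qab] := qs _ _ _ Mx; first by lia.
apply: le_lt_trans (lt_le_trans qab _).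
  by rewrite ler1n; lia.
by rewrite ler_pM2l // ler_nat; lia.
Qed.

Lemma q_decreasing_ones_below (s : seq bool) (m p : nat) :
    q_decreasing q s -> q * m%:R <= 1 -> (p <= m)%N ->
  nth false s m -> nth false s p.
Proof.
move=> qs; elim: m => [|m IHm] qm; first by rewrite leqn0 => /eqP->.
rewrite leq_eqVlt ltnS => /predU1P[->//|pm sm].
apply: IHm => //; last exact: q_decreasing_prev_one sm.
by apply: le_trans qm; rewrite ler_pM2l // ler_nat.
Qed.

(** Minimality of [least_word i], in a form that turns having a 1 at [i] into an order relation. *)
Lemma least_word_le i w : (least_word i <= w)%O = tnth w i.
Proof.
apply/qword_leP/idP => [->//|wi k]; first exact: tnth_least_word.
rewrite tnth_block ltnS /first_one; have [qi /= ki|_] := leP (q * i%:R) 1.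
  rewrite (tnth_nth false).
  apply: (q_decreasing_ones_below (@qwordP _ _ _ w) qi ki).
  by rewrite -tnth_nth.
by rewrite -eqn_leq => /eqP /val_inj <-.
Qed.

(** The block of [least_word i] ends at [i], so losing that 1 leaves at most the block of the
    cover. *)
Lemma le_least_word_cover i v :
  (v <= least_word i)%O -> ~~ tnth v i -> (v <= least_word_cover i)%O.
Proof.
move=> /qword_leP vi vFi; apply/qword_leP => k vk.
have := vi k vk; rewrite !tnth_block ltnS (leq_eqVlt k).
case/andP=> -> /predU1P[ki|->] //; move/ord_inj: ki => ki.
by rewrite -ki vk in vFi.
Qed.

Lemma least_word_cover_lt i : (least_word_cover i < least_word i)%O.
Proof.
rewrite lt_leAnge least_word_le tnth_least_word_cover andbT.
by apply/qword_leP => k; rewrite !tnth_block; lia.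
Qed.

(** If the words of [i] and [j] agreed with [i] and [j] distinct, erasing the 1 at [i] would keep
    the 1 at [j], so the cover would still be above [least_word j], that is, above
    [least_word i]. *)
Lemma least_word_inj : injective least_word.
Proof.
move=> i j ij; apply/eqP/negPn/negP => neq.
have := least_word_cover_lt i; rewrite lt_leAnge => /andP[_ /negP[]].
rewrite ij least_word_le; have := tnth_least_word j.
by rewrite -ij !tnth_block; move: neq; rewrite -val_eqE /=; lia.
Qed.

Lemma least_word_irreducible i : join_irreducible (least_word i).
Proof.
apply/andP; split.
  apply: contraFneq (tnth_least_word_cover i) => i0.
  by rewrite -least_word_le i0 le0x.
apply/forallP => v; apply/forallP => w; apply/implyP => /eqP iE.
have vi : (v <= least_word i)%O by rewrite iE leUl.
have wi : (w <= least_word i)%O by rewrite iE leUr.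
rewrite !eq_le vi wi !andbT !least_word_le.
(* If both joinands lack the 1 at [i], both lie below the cover, and so does their join. *)
apply: contraFT (lt_geF (least_word_cover_lt i)) => /norP[vFi wFi].
by rewrite {1}iE leUx !le_least_word_cover.
Qed.

Lemma qword_join_least w : w = (\join_(i | tnth w i) least_word i)%O.
Proof.
apply/le_anti/andP; split; last first.
  by apply/joinsP => i; rewrite least_word_le.
by apply/qword_leP => i wi; rewrite -least_word_le; exact: joins_sup.
Qed.

End JoinIrreducibleWords.

Theorem mainTheorem2 (R : realType) (q : R) (hq : 0 < q) (n : nat)
    (hn : (1 <= n)%N) :
  #|[set P : qword q n | join_irreducible P]| = n.
Proof.
(* By injectivity, [n] is the size of the image of [least_word]. *)
rewrite -[RHS]card_ord -cardsT -(card_imset _ (@least_word_inj R q n hq)).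
apply: eq_card => P; rewrite inE; apply/idP/imsetP => [irrP|[i _ ->]].
  have [i _ ->] := join_irreducible_bigjoin irrP (qword_join_least hq P).
  by exists i.
exact: least_word_irreducible.
Qed.
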